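(* Let $T\in(0,\infty)$, let $\Omega=C([0,T],\mathbb{R})$, let $W$ be the coordinate process on $\Omega$, let $\mathsf{P}$ be the Wiener measure, let $(\mathcal{F}_t)_{t\in[0,T]}$ be the filtration generated by $W$ and augmented to satisfy the usual conditions, and let $\mathcal{F}=\mathcal{F}_T$. Let $f\colon\mathbb{R}\to\mathbb{R}$ be a strictly increasing continuous function with $\lim_{x\to-\infty}f(x)=1$ and $\lim_{x\to\infty}f(x)=2$. Define the progressively measurable functional $\xi$ by $$\xi(\omega,t)=\begin{cases}\dfrac{f(\omega(t))}{T-t}&\text{if }t\in[0,T),\\[2mm] 0&\text{if }t=T,\end{cases}\qquad \omega\in\Omega,$$ and put $X(t)=\xi(W(\cdot),t)$, $t\in[0,T]$. Then there exists no candidate measure corresponding to $X$, i.e. there is no probability measure $\mathsf{Q}^C$ on $(\Omega,\mathcal{F})$ for which there is a $\mathsf{Q}^C$-Brownian motion $W^{\mathsf{Q}^C}=(W^{\mathsf{Q}^C}(t))_{t\in[0,T]}$ with $$X(t)=\xi\left(W^{\mathsf{Q}^C}(\cdot)+\int_0^{\cdot}X(u)\,du,\;t\right),\qquad t\in[0,T).$$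
   Context: For $t\in[0,T)$ the value $\xi(\omega,t)$ depends only on $\omega(t)$, so the displayed identity for $t\in[0,T)$ is meaningful for paths that are continuous on $[0,T)$; it reads $X(t)=f\big(W^{\mathsf{Q}^C}(t)+\int_0^tX(u)\,du\big)/(T-t)$, required $\mathsf{Q}^C$-almost surely. A Brownian motion on $[0,T]$ is real-valued with (almost surely) continuous paths on the closed interval $[0,T]$. The explosion time $\tau^{M_X}=\lim_{N\to\infty}\inf\{t:\int_0^t|X(u)|^2\,du\ge N\}$ of this $X$ equals $T$, so the identity is required for $t\in[0,T)$. *)

(* Defs.v *)
From HB Require Import structures.
From mathcomp Require Import all_boot all_order all_algebra.
From mathcomp Require Import all_classical all_reals all_analysis.

Set Implicit Arguments.
Unset Strict Implicit.
Unset Printing Implicit Defensive.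

Import Order.TTheory GRing.Theory Num.Theory.
Import numFieldNormedType.Exports.

Local Open Scope classical_set_scope.
Local Open Scope ring_scope.

(* [0, T] as a type, with the topology induced by R. *)
Notation time T := (set_type `[0, T]%classic).

(* C([0, T], R) *)
Definition path_space (R : realType) (T : R) : Type :=
  continuousType (time T) R.
HB.instance Definition _ (R : realType) (T : R) :=
  Choice.copy (path_space T) (continuousType (time T) R).

Lemma cst_time_continuous (R : realType) (T : R) :
  continuous (cst 0 : time T -> R).
Proof. by move=> t; exact: cst_continuous. Qed.

(* The library's generated sigma-algebras require a pointed carrier. *)
HB.instance Definition _ (R : realType) (T : R) :=
  isPointed.Build (path_space T) (mkcts (@cst_time_continuous R T)).

Definition Wproc (R : realType) (T : R) (t : time T) (w : path_space T) : R :=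
  w t.

(* The events {W(s) \in A} with s <= t and A Borel. *)
Definition cylinders (R : realType) (T : R) (t : R) : set (set (path_space T)) :=
  \bigcup_(s in [set s : time T | val s <= t])
    preimage_set_system setT (Wproc s) measurable.

(* C([0, T], R) with the sigma-algebra generated by W, without completion. *)
Definition raw_path_space (R : realType) (T : R) :=
  g_sigma_algebraType (@cylinders R T T).

(* Standard Brownian motion (B(t))_{t in [0, T]} under Q: no filtration is
   prescribed, so adaptedness to a given filtration is not required. *)
Definition brownian_motion (R : realType) (T : R) (d : measure_display)
    (S : measurableType d) (Q : probability S R) (B : time T -> S -> R) : Prop :=
  [/\ forall t, measurable_fun setT (B t),
      forall t, val t = 0 -> {ae Q, forall w, B t w = 0},
      forall (n : nat) (t : nat -> time T) (A : nat -> set R),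
        (forall i j, (i <= j)%N -> val (t i) <= val (t j)) ->
        (forall i, measurable (A i)) ->
        Q (\bigcap_(i in `I_n) ((fun w => B (t i.+1) w - B (t i) w) @^-1` A i)) =
        (\prod_(i < n) Q ((fun w => B (t i.+1) w - B (t i) w)%R @^-1` A i))%E,
      forall s t, val s < val t -> forall A : set R, measurable A ->
        Q ((fun w => B t w - B s w) @^-1` A) =
        normal_prob 0 (Num.sqrt (val t - val s)) A
    & {ae Q, forall w, continuous (fun t => B t w)}].

Definition wiener_measure (R : realType) (T : R)
    (P : probability (raw_path_space T) R) : Prop :=
  brownian_motion P (@Wproc R T).

(* F_t as the intersection over s > t of sigma(W(u), u <= s) enlarged by the
   P-null sets.  All real s > t are allowed: for s > T the cylinder sets are
   those of time T, so F_T is the P-completion of sigma(W(u), u <= T). *)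
Definition augmented_filtration (R : realType) (T : R)
    (P : probability (raw_path_space T) R) (t : R) : set (set (path_space T)) :=
  \bigcap_(s in [set s : R | t < s]) <<s @cylinders R T s `|` P.-negligible >>.

(* (Omega, F) with F = F_T. *)
Definition augmented_path_space (R : realType) (T : R)
    (P : probability (raw_path_space T) R) :=
  g_sigma_algebraType (augmented_filtration P T).

(* The functional is defined on all functions on [0, T]: the path
   B + \int_0^. X(u) du to which it is applied need not be continuous at T. *)
Definition xi (R : realType) (T : R) (f : R -> R) (w : time T -> R)
    (t : time T) : R :=
  if val t < T then f (w t) / (T - val t) else 0.

Definition Xproc (R : realType) (T : R) (f : R -> R) (t : time T)
    (w : path_space T) : R :=
  xi f (fun s => Wproc s w) t.

(* 'valL_0 extends X(., w) from [0, T] to R by 0, so that it can be integrated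
   against the Lebesgue measure; the integral is finite for u < T.  The identity
   is required up to the explosion time of X, which is T. *)
Definition candidate_measure (R : realType) (T : R) (f : R -> R)
    (P : probability (raw_path_space T) R)
    (Q : probability (augmented_path_space P) R) : Prop :=
  exists B : time T -> augmented_path_space P -> R,
    brownian_motion Q B /\
    {ae Q, forall w, forall t : time T, val t < T ->
      Xproc f t w =
      xi f (fun u => B u w +
              \int[lebesgue_measure]_(v in `[0, val u]) 'valL_0 (fun s => Xproc f s w) v)
           t}.

(* Main.v *)
Require Import Defs.
From mathcomp Require Import all_boot all_order all_algebra.
From mathcomp Require Import all_classical all_reals all_analysis.
From mathcomp Require Import lra.

Import Order.TTheory GRing.Theory Num.Theory.
Import numFieldNormedType.Exports.

Local Open Scope classical_set_scope.
Local Open Scope ring_scope.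

(** A candidate measure would produce a path that escapes to infinity at [T],
    and there is no such path in C([0, T]).  Since [f] is injective, the
    identity [X(t) = xi(B + \int_0^. X, t)] forces, almost surely,
    [W(t) - B(t) = \int_0^t X(u) du] for all [t < T].  Both [W] and [B] are
    continuous on the closed interval [0, T], so the left-hand side converges
    as [t] increases to [T].  But [f > 1] ([increasing_gt_lim_ninfty]) gives
    [X(u) >= 1 / (T - u)], whose integral diverges logarithmically at [T]
    ([Rintegral_not_cvg_at_left]).  As [Q] has mass 1, some path satisfies both
    almost sure properties, and that single path gives the contradiction.

    The pathwise argument takes place on the real line: paths are precomposed
    with the retraction [clamp_time] of the line onto [0, T], so that integrands
    and limits at [T] concern functions of a real variable. *)

Lemma increasing_gt_lim_ninfty (R : realType) (f : R -> R) (l : R) :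
  {homo f : x y / x < y} -> f x @[x --> -oo] --> l -> forall x, l < f x.
Proof.
move=> f_incr f_l x; apply: (@le_lt_trans _ _ (f (x - 1))); last first.
  by apply: f_incr; rewrite ltrBlDr ltrDl.
rewrite -(cvg_lim _ f_l)//; apply: limr_le; first by apply/cvg_ex; exists l.
near=> y; apply/ltW/f_incr; near: y; apply: nbhs_ninfty_lt.
exact: num_real.
Unshelve. all: by end_near. Qed.

Section explosion.
Variables (R : realType) (T : R) (g : R -> R).
Hypothesis g_int : forall t, 0 <= t < T ->
  lebesgue_measure.-integrable `[0, t] (EFin \o g).
Hypothesis g_ge : forall v, 0 <= v < T -> (T - v)^-1 <= g v.

Local Notation G := (fun t => \int[lebesgue_measure]_(v in `[0, t]) g v).

(** On [s, t] the integrand is at least its bound at the left end, [1 / (T - s)],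
    because [1 / (T - v)] increases with [v]. *)
Lemma Rintegral_increment_ge (s t : R) :
  0 <= s <= t -> t < T -> (t - s) / (T - s) <= G t - G s.
Proof.
move=> /andP[s0 st] tT.
have gt : lebesgue_measure.-integrable `[0, t] (EFin \o g).
  by apply: g_int; rewrite tT (le_trans s0 st).
rewrite (Rintegral_itvB gt) ?bnd_simp//.
have muE : fine (lebesgue_measure `]s, t]) = t - s.
  rewrite lebesgue_measure_itv/= lte_fin.
  by move: st; rewrite le_eqVlt => /predU1P[->|->//]; rewrite ltxx subrr.
rewrite -muE mulrC -Rintegral_cst//; apply: le_Rintegral => //.
- apply/integrableP; split; first exact: measurable_cst.
  rewrite integral_cst//= lebesgue_measure_itv/= lte_fin.
  by case: ifP => _; rewrite ?mule0// -EFinM ltry.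
- apply: integrableS gt => //.
  by apply: subset_itvr; rewrite bnd_simp.
- move=> v /=; rewrite in_itv/= => /andP[sv vt].
  apply: (@le_trans _ _ (T - v)^-1); last by apply: g_ge; lra.
  by rewrite lef_pV2 ?posrE; lra.
Qed.

(** The Cauchy criterion fails: halving the distance to [T] adds at least 1/2 to
    the integral, however close to [T] one starts. *)
Lemma Rintegral_not_cvg_at_left (l : R) : 0 < T -> ~ (G t @[t --> T^'-] --> l).
Proof.
move=> T0 /cvgrPdist_lt /(_ (4^-1)) /(_ ltac:(lra)) [e /= e0 Gl].
(* [s] lies within [e] of [T], and [t] halves its distance to [T]. *)
pose s := Num.max 0 (T - e / 2); pose t := (s + T) / 2.
have s0 : 0 <= s by rewrite le_max lexx.
have sT : s < T by rewrite gt_max T0/=; lra.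
have se : T - e / 2 <= s by rewrite le_max lexx orbT.
have Gs : `|l - G s| < 4^-1.
  by apply: Gl => //=; rewrite gtr0_norm; lra.
have Gt : `|l - G t| < 4^-1.
  by apply: Gl => //=; rewrite ?gtr0_norm /t; lra.
have := @Rintegral_increment_ge s t.
have -> : (t - s) / (T - s) = 2^-1.
  rewrite (_ : t - s = (T - s) / 2); last by rewrite /t; lra.
  by rewrite mulrAC divff ?mul1r//; lra.
have st : 0 <= s <= t by rewrite s0/= /t; lra.
have tT : t < T by rewrite /t; lra.
move/(_ st tT).
move: Gs Gt; rewrite !ltr_norml; lra.
Qed.

End explosion.

Section clamp.
Variables (R : realType) (T : R).
Hypothesis T_ge0 : 0 <= T.

Definition clamp (v : R) : R := Num.min T (Num.max 0 v).

Lemma clamp_in (v : R) : clamp v \in `[0, T]%classic.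
Proof.
by rewrite inE /= in_itv/= /clamp le_min ge_min lexx T_ge0 le_max lexx.
Qed.

Definition clamp_time (v : R) : time T := SigSub (clamp_in v).

Lemma clamp_time_continuous : continuous clamp_time.
Proof.
apply: continuous_comp_initial => v /=.
apply: (@continuous_min R R (cst T) (fun v => Num.max 0 v)); first exact: cvg_cst.
by apply: (@continuous_max R R (cst 0) id); [exact: cvg_cst|exact: cvg_id].
Qed.

Lemma val_clamp_time (v : R) : 0 <= v <= T -> val (clamp_time v) = v.
Proof.
by move=> /andP[v0 vT] /=; rewrite /clamp (max_idPr v0) (min_idPr vT).
Qed.

Lemma valL_clamp_time (h : time T -> R) (v : R) :
  0 <= v <= T -> 'valL_0 h v = h (clamp_time v).
Proof.
move=> vT; rewrite -{1}(val_clamp_time v vT).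
exact: (congr1 (fun k => k (clamp_time v)) (valLK 0 h)).
Qed.

End clamp.

Theorem mainTheorem2 (R : realType) (T : R) (T_gt0 : 0 < T)
    (P : probability (raw_path_space T) R) (P_wiener : wiener_measure P)
    (f : R -> R) (f_incr : {homo f : x y / x < y}) (f_cont : continuous f)
    (f_ninfty : f x @[x --> -oo] --> (1 : R))
    (f_pinfty : f x @[x --> +oo] --> (2 : R)) :
  ~ exists Q : probability (augmented_path_space P) R, candidate_measure f Q.
Proof.
case=> Q [B [[_ _ _ _ B_cont] W_fix]].
have Q_proper : ProperFilter (almost_everywhere Q).
  apply: ae_properfilter_algebraOfSetsType.
  by rewrite [X in (_ < X)%E]probability_setT lte01.
have [w [Bw Ww]] := filter_ex (filterI B_cont W_fix).
have T_ge0 := ltW T_gt0.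
pose p := clamp_time R T T_ge0.
pose g v := f (w (p v)) / (T - v).
have wp_cont : continuous (fun v => w (p v)).
  move=> v; apply: continuous_comp; first exact: clamp_time_continuous.
  exact: (@cts_fun _ _ w).
have XE (v : R) : 0 <= v < T -> 'valL_0 (fun s => Xproc f s w) v = g v.
  move=> /andP[v0 vT]; rewrite (valL_clamp_time _ _ T_ge0) ?v0 ?ltW//.
  by rewrite /Xproc /xi val_clamp_time ?v0 ?ltW// vT.
have g_int (t : R) : 0 <= t < T -> lebesgue_measure.-integrable `[0, t] (EFin \o g).
  move=> /andP[t0 tT]; apply: continuous_compact_integrable.
    exact: segment_compact.
  apply: continuous_in_subspaceT => v; rewrite inE/= in_itv/= => /andP[v0 vt].
  apply: cvgM.
    by apply: (continuous_comp (wp_cont v)); exact: f_cont.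
  by apply: cvgV; [lra|apply: cvgB; [exact: cvg_cst|exact: cvg_id]].
have g_ge (v : R) : 0 <= v < T -> (T - v)^-1 <= g v.
  move=> /andP[v0 vT]; rewrite ler_peMl ?invr_ge0; [|lra|].
    by [].
  exact/ltW/(increasing_gt_lim_ninfty _ _ _ f_incr f_ninfty).
(* Inverting [f] turns the identity for [X] into one for the paths. *)
have f_inj : injective f by apply: inc_inj; exact: le_mono.
have driftE (v : R) : 0 <= v < T ->
    \int[lebesgue_measure]_(u in `[0, v]) g u = w (p v) - B (p v) w.
  move=> /andP[v0 vT].
  have pv : val (p v) = v by rewrite val_clamp_time ?v0 ?ltW.
  have := Ww (p v); rewrite /Xproc /xi pv vT => /(_ isT).
  move=> /(mulIf _) /f_inj; rewrite /Wproc => ->; last first.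
    by rewrite invr_eq0; lra.
  rewrite addrC addKr; apply: eq_Rintegral => u; rewrite inE/= in_itv/=.
  by move=> /andP[u0 uv]; rewrite -XE// u0 (le_lt_trans uv vT).
(* By continuity at [T] the drift tends to the finite value W(T) - B(T). *)
apply: (@Rintegral_not_cvg_at_left R T g g_int g_ge (w (p T) - B (p T) w)) => //.
apply: (@cvg_trans _ ((fun v => w (p v) - B (p v) w) @ T^'-)).
  apply: near_eq_cvg; near=> v; apply/esym/driftE/andP; split.
    by near: v; exact: nbhs_left_ge.
  by near: v; exact: nbhs_left_lt.
apply: cvg_at_left_filter; apply: cvgB; first exact: wp_cont.
apply: (@continuous_comp _ _ _ p (B^~ w)); last exact: Bw.
exact: clamp_time_continuous.
Unshelve. all: by end_near. Qed.
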